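(* Let $N\ge 1$ be an integer and let $\zeta_{1/2,N}:\mathbb{R}\to\mathbb{C}$ be the function $\zeta_{1/2,N}(y)=\sum_{n=1}^N n^{-1/2}e^{-iy\log n}$. For every integer $J\ge 0$, let $\zeta_{1/2,N}^{(J)}$ denote its $J$-th derivative with respect to $y$. Then for all integers $J\ge 0$, $$\|\zeta_{1/2,N}^{(J)}\|_{\overline{BV}}\ \ge\ \max_{1\le n\le N} n^{-1/2}(\log n)^{J+1}.$$
   Context: Average total variation: for $g:\mathbb{R}\to\mathbb{C}$ and $a<b$, $V_{[a,b]}(g)$ is the supremum of $\sum_{i=1}^m |g(x_i)-g(x_{i-1})|$ over all finite partitions $a=x_0<\dots<x_m=b$. The average total variation of $g$ is the limit $\|g\|_{\overline{BV}}=\overline{V}_{\mathbb{R}}(g)=\lim_{T\to\infty}\frac1T V_{[0,T]}(g)$. *)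

(* Defs.v *)
From Stdlib Require Import Reals List RList.
From Coquelicot Require Import Coquelicot.
Open Scope R_scope.

Definition Cexp (z : C) : C :=
  (RtoC (exp (Re z)) * (cos (Im z), sin (Im z)))%C.

Definition zeta_half (N : nat) (y : R) : C :=
  sum_n_m (fun n : nat =>
    (RtoC (Rpower (INR n) (-1/2))
     * Cexp (- (Ci * RtoC y * RtoC (ln (INR n)))))%C) 1 N.

(* Derivative of a complex-valued function of a real variable: the unique [l]
   with [is_derive f x l], C being a normed module over R; arbitrary where [f]
   is not differentiable. *)
Definition CDerive (f : R -> C) (x : R) : C :=
  iota (T := C_R_CompleteNormedModule)
    (fun l : C => is_derive (K := R_AbsRing) (V := C_R_NormedModule) f x l).

Fixpoint CDerive_n (f : R -> C) (n : nat) : R -> C :=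
  match n with
  | O => f
  | S k => CDerive (CDerive_n f k)
  end.

(* [a = x 0 < x 1 < ... < x m = b]; the values of [x] beyond [m] are ignored. *)
Definition is_partition (a b : R) (m : nat) (x : nat -> R) : Prop :=
  x 0%nat = a /\ x m = b /\ forall i : nat, (i < m)%nat -> x i < x (S i).

Definition variation (g : R -> C) (m : nat) (x : nat -> R) : R :=
  sum_n_m (fun i : nat => Cmod (g (x i) - g (x (pred i)))) 1 m.

(* Meant for [a < b]. *)
Definition total_variation (g : R -> C) (a b : R) : Rbar :=
  Lub_Rbar (fun s : R => exists (m : nat) (x : nat -> R),
    is_partition a b m x /\ s = variation g m x).

(* Finiteness is required explicitly because [real] sends infinite values
   to 0. *)
Definition is_average_variation (g : R -> C) (L : R) : Prop :=
  (forall T : R, 0 < T -> is_finite (total_variation g 0 T)) /\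
  is_lim (fun T : R => real (total_variation g 0 T) / T) p_infty L.

Definition max_upto (a : nat -> R) (N : nat) : R :=
  MaxRlist (map a (seq 1 N)).

(* Main.v *)
Require Import Defs.
From Stdlib Require Import Reals Lra Lia List RList.
From Coquelicot Require Import Coquelicot.
Open Scope R_scope.

(** The derivative of order [J] of the zeta sum is, up to a constant phase, the
    trigonometric sum with frequencies [log n] and nonnegative amplitudes
    [n^(-1/2) (log n)^J]: each differentiation multiplies the amplitude of a
    term by its frequency and turns all the phases by the same [- PI / 2]
    ([is_derive_wave], [CDerive_n_zeta_half]).  Such a curve [g] is C1, so its
    variation on [[0, T]] is its arc length, the integral of [|g'|]
    ([total_variation_C1]), and the average variation is the mean value of
    [|g'|].

    The mean value exists because [|g'|^2] is a bounded real trigonometric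
    polynomial, and polynomials in it are trigonometric polynomials again, which
    have mean values by explicit integration.  The square root is a uniform
    limit of polynomials on a segment, so [|g'|] is a uniform limit of
    trigonometric polynomials, and mean values pass to uniform limits
    ([trig_poly_modulus_mean]).

    For the lower bound on the term of index [n], project [g'(t)] on the unit
    vector that rotates with the [n]-th term.  The projection is at most
    [|g'(t)|].  In it the [n]-th term becomes the constant
    [n^(-1/2) (log n)^(J+1)], while every other term becomes a multiple of a
    cosine with nonnegative coefficient and hence nonnegative mean
    ([wave_amplitude_le_mean]). *)

(** * Projections of plane vectors *)

(** Cauchy-Schwarz.  With [exists_polar_unit] it gives [Cmod z] as the greatest
    projection of [z] on a unit vector, which reduces every estimate on the
    modulus below to one real function. *)
Lemma dot_unit_le_Cmod (p q : R) (z : C) :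
  p * p + q * q = 1 -> p * fst z + q * snd z <= Cmod z.
Proof.
intros Hpq; unfold Cmod.
apply Rsqr_incr_0_var; [|apply sqrt_pos].
rewrite Rsqr_sqrt by nra.
unfold Rsqr; pose proof (pow2_ge_0 (p * snd z - q * fst z)); nra.
Qed.

Lemma exists_polar_unit (z : C) :
  exists p q, p * p + q * q = 1 /\ p * fst z + q * snd z = Cmod z.
Proof.
destruct (Req_dec (Cmod z) 0) as [H0|H0].
- exists 1, 0; rewrite H0, (Cmod_eq_0 z H0); simpl; lra.
- assert (HC : Cmod z * Cmod z = fst z * fst z + snd z * snd z).
  { unfold Cmod; rewrite sqrt_sqrt; nra. }
  exists (fst z / Cmod z), (snd z / Cmod z); split.
  + replace 1 with ((Cmod z * Cmod z) / (Cmod z * Cmod z)) by (field; auto).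
    rewrite HC at 1; field; auto.
  + apply (Rmult_eq_reg_r (Cmod z)); auto.
    rewrite HC; field; auto.
Qed.

(** * Components of plane curves *)

Lemma continuous_Re (h : R -> C) (x : R) :
  continuous h x -> continuous (fun t => fst (h t)) x.
Proof.
intros H; apply (continuous_comp h fst); auto.
destruct (h x); apply continuous_fst.
Qed.

Lemma continuous_Im (h : R -> C) (x : R) :
  continuous h x -> continuous (fun t => snd (h t)) x.
Proof.
intros H; apply (continuous_comp h snd); auto.
destruct (h x); apply continuous_snd.
Qed.

Lemma continuous_dot (p q : R) (h : R -> C) (x : R) :
  continuous h x -> continuous (fun t => p * fst (h t) + q * snd (h t)) x.
Proof.
intros H.
apply (continuous_plus (fun t => p * fst (h t)) (fun t => q * snd (h t))).
- apply (continuous_scal_r p (fun t => fst (h t))), continuous_Re, H.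
- apply (continuous_scal_r q (fun t => snd (h t))), continuous_Im, H.
Qed.

Lemma continuous_Cmod_comp (h : R -> C) (x : R) :
  continuous h x -> continuous (fun t => Cmod (h t)) x.
Proof.
intros H; unfold Cmod; apply continuous_sqrt_comp; simpl.
apply (continuous_plus (fun t => fst (h t) * (fst (h t) * 1))
                       (fun t => snd (h t) * (snd (h t) * 1))).
- apply (continuous_mult (fun t => fst (h t)) (fun t => fst (h t) * 1)).
  + apply continuous_Re, H.
  + apply (continuous_mult (fun t => fst (h t)) (fun t => 1)).
    * apply continuous_Re, H.
    * apply continuous_const.
- apply (continuous_mult (fun t => snd (h t)) (fun t => snd (h t) * 1)).
  + apply continuous_Im, H.
  + apply (continuous_mult (fun t => snd (h t)) (fun t => 1)).
    * apply continuous_Im, H.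
    * apply continuous_const.
Qed.

Lemma ex_RInt_continuous_everywhere (f : R -> R) (a b : R) :
  (forall x, continuous f x) -> ex_RInt f a b.
Proof.
intros H; apply (ex_RInt_continuous (V := R_CompleteNormedModule)); auto.
Qed.

Lemma is_derive_components (g : R -> C) (x : R) (l : C) :
  is_derive (K := R_AbsRing) (V := C_R_NormedModule) g x l ->
  is_derive (fun t => fst (g t)) x (fst l) /\
  is_derive (fun t => snd (g t)) x (snd l).
Proof.
intros H; split.
- apply (filterdiff_comp' g fst x _ fst H).
  apply (filterdiff_linear _ (is_linear_fst (U := R_NormedModule) (V := R_NormedModule))).
- apply (filterdiff_comp' g snd x _ snd H).
  apply (filterdiff_linear _ (is_linear_snd (U := R_NormedModule) (V := R_NormedModule))).
Qed.

Lemma is_derive_pair (u v : R -> R) (x du dv : R) :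
  is_derive u x du -> is_derive v x dv ->
  is_derive (K := R_AbsRing) (V := C_R_NormedModule)
    (fun t => (u t, v t)) x (du, dv).
Proof.
intros Hu Hv.
apply (filterdiff_comp'_2 (W := prod_NormedModule R_AbsRing R_NormedModule R_NormedModule)
         u v pair x _ _ pair Hu Hv).
apply (filterdiff_ext_lin _ (fun t => t)).
- apply (filterdiff_ext (fun t => t)).
  + now intros [].
  + apply filterdiff_id.
- now intros [].
Qed.

(** A definite description picks the derivative, so it only has to be unique;
    uniqueness is that of real derivatives, component by component. *)
Lemma CDerive_eq (g : R -> C) (x : R) (l : C) :
  is_derive (K := R_AbsRing) (V := C_R_NormedModule) g x l -> CDerive g x = l.
Proof.
intros H; unfold CDerive.
apply (iota_unique (V := C_R_CompleteNormedModule)); auto.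
intros y Hy.
destruct (is_derive_components _ _ _ H) as [H1 H2].
destruct (is_derive_components _ _ _ Hy) as [H3 H4].
apply is_derive_unique in H1; apply is_derive_unique in H2.
apply is_derive_unique in H3; apply is_derive_unique in H4.
destruct y, l; simpl in *; congruence.
Qed.

(** * The variation of a C1 curve is its length *)

Definition is_C1_curve (g h : R -> C) : Prop :=
  forall x,
    is_derive (K := R_AbsRing) (V := C_R_NormedModule) g x (h x) /\
    continuous h x.

(** Here [h] is the velocity of the curve, not its position. *)
Definition arc_length (h : R -> C) (a b : R) : R :=
  RInt (fun t => Cmod (h t)) a b.

(** Fundamental theorem of calculus for the projection of [g] on [(p, q)]. *)
Lemma dot_increment_RInt (g h : R -> C) (p q a b : R) :
  is_C1_curve g h ->
  p * fst (g b - g a)%C + q * snd (g b - g a)%C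
  = RInt (fun t => p * fst (h t) + q * snd (h t)) a b.
Proof.
intros Hg; symmetry.
set (f := fun t => p * fst (g t) + q * snd (g t)).
replace (p * fst (g b - g a)%C + q * snd (g b - g a)%C)
  with (minus (f b) (f a)) by (unfold f, minus, plus, opp; simpl; ring).
apply is_RInt_unique, (is_RInt_derive (V := R_CompleteNormedModule) f).
- intros x _.
  destruct (is_derive_components _ _ _ (proj1 (Hg x))) as [H1 H2].
  apply (is_derive_plus (V := R_NormedModule) (fun t => p * fst (g t)) (fun t => q * snd (g t))).
  + apply (is_derive_scal (fun t => fst (g t))), H1.
  + apply (is_derive_scal (fun t => snd (g t))), H2.
- intros x _; apply continuous_dot, Hg.
Qed.

(** Project on the direction of the chord: the projection then grows by the full
    length of the chord, at a rate of at most the speed. *)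
Lemma chord_le_arc_length (g h : R -> C) (a b : R) :
  is_C1_curve g h -> a <= b -> Cmod (g b - g a) <= arc_length h a b.
Proof.
intros Hg Hab.
destruct (exists_polar_unit (g b - g a)%C) as [p [q [Hpq <-]]].
rewrite (dot_increment_RInt g h p q a b Hg).
apply RInt_le; auto.
- apply ex_RInt_continuous_everywhere; intros x; apply continuous_dot, Hg.
- apply ex_RInt_continuous_everywhere; intros x; apply continuous_Cmod_comp, Hg.
- intros t _; now apply dot_unit_le_Cmod.
Qed.

(** Project on the direction of the initial velocity [h a].  As [h t] stays within
    [eps] of [h a], its projection is at least [Cmod (h a) - eps], hence at least
    [Cmod (h t) - 2 * eps]. *)
Lemma arc_length_le_chord (g h : R -> C) (a b eps : R) :
  is_C1_curve g h -> a <= b ->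
  (forall t, a < t < b -> Cmod (h t - h a) <= eps) ->
  arc_length h a b - 2 * eps * (b - a) <= Cmod (g b - g a).
Proof.
intros Hg Hab Heps.
destruct (exists_polar_unit (h a)) as [p [q [Hpq Hdot]]].
apply Rle_trans with (2 := dot_unit_le_Cmod p q _ Hpq).
rewrite (dot_increment_RInt g h p q a b Hg).
replace (arc_length h a b - 2 * eps * (b - a))
  with (RInt (fun t => Cmod (h t) - 2 * eps) a b).
- apply RInt_le; auto.
  + apply ex_RInt_continuous_everywhere; intros x.
    apply (continuous_minus (fun t => Cmod (h t)) (fun _ => 2 * eps)).
    * apply continuous_Cmod_comp, Hg.
    * apply continuous_const.
  + apply ex_RInt_continuous_everywhere; intros x; apply continuous_dot, Hg.
  + intros t Ht; specialize (Heps t Ht).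
    (* The unit vector [(- p, - q)] bounds the projection of [h t - h a] from
       below. *)
    assert (Hn : (- p) * (- p) + (- q) * (- q) = 1) by nra.
    pose proof (dot_unit_le_Cmod _ _ (h t - h a)%C Hn) as H1.
    pose proof (Cmod_triangle (h t - h a) (h a)) as H2.
    replace (h t - h a + h a)%C with (h t) in H2 by ring.
    destruct (h t), (h a); simpl in *; lra.
- unfold arc_length.
  assert (HI : is_RInt (fun t => Cmod (h t) - 2 * eps) a b
                 (minus (RInt (fun t => Cmod (h t)) a b) (scal (b - a) (2 * eps)))).
  { apply (is_RInt_minus (fun t => Cmod (h t)) (fun _ => 2 * eps)).
    - apply (RInt_correct (fun t => Cmod (h t))).
      apply ex_RInt_continuous_everywhere; intros x; apply continuous_Cmod_comp, Hg.
    - apply (is_RInt_const (V := R_NormedModule)). }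
  rewrite (is_RInt_unique (V := R_CompleteNormedModule) _ _ _ _ HI).
  unfold minus, plus, opp, scal; simpl; unfold mult; simpl; ring.
Qed.

Lemma uniform_continuity_on_segment (h : R -> C) (a b eps : R) :
  (forall x, continuous h x) -> 0 < eps ->
  exists delta, 0 < delta /\ forall x y, a <= x <= b -> a <= y <= b ->
    Rabs (x - y) < delta -> Cmod (h x - h y) <= eps.
Proof.
intros Hc He.
assert (He2 : 0 < eps / 2) by lra.
destruct (@Heine_cor2 (fun t => fst (h t)) a b
  (fun x _ => proj2 (continuity_pt_filterlim _ _) (continuous_Re h x (Hc x)))
  (mkposreal _ He2)) as [d1 H1].
destruct (@Heine_cor2 (fun t => snd (h t)) a b
  (fun x _ => proj2 (continuity_pt_filterlim _ _) (continuous_Im h x (Hc x)))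
  (mkposreal _ He2)) as [d2 H2].
exists (Rmin d1 d2); split.
- apply Rmin_pos; apply cond_pos.
- intros x y Hx Hy Hxy.
  specialize (H1 x y Hx Hy (Rlt_le_trans _ _ _ Hxy (Rmin_l _ _))).
  specialize (H2 x y Hx Hy (Rlt_le_trans _ _ _ Hxy (Rmin_r _ _))).
  simpl in H1, H2.
  destruct (exists_polar_unit (h x - h y)%C) as [p [q [Hpq <-]]].
  apply Rabs_def2 in H1; apply Rabs_def2 in H2.
  assert (Hp : Rabs p <= 1) by (apply Rabs_le; nra).
  assert (Hq : Rabs q <= 1) by (apply Rabs_le; nra).
  apply Rabs_le_between in Hp; apply Rabs_le_between in Hq.
  simpl; nra.
Qed.

Lemma arc_length_Chasles (h : R -> C) (a b c : R) :
  (forall x, continuous h x) ->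
  arc_length h a b + arc_length h b c = arc_length h a c.
Proof.
intros Hc; unfold arc_length.
apply (RInt_Chasles (V := R_CompleteNormedModule) (fun t => Cmod (h t)));
  apply ex_RInt_continuous_everywhere; intros x; apply continuous_Cmod_comp, Hc.
Qed.

Lemma arc_length_partition (h : R -> C) (x : nat -> R) (m : nat) :
  (forall t, continuous h t) ->
  sum_n_m (fun i => arc_length h (x (pred i)) (x i)) 1 m
  = arc_length h (x 0%nat) (x m).
Proof.
intros Hc; induction m as [|m IH].
- rewrite sum_n_m_zero by lia.
  unfold arc_length; now rewrite RInt_point.
- rewrite sum_n_Sm by lia; rewrite IH.
  apply (arc_length_Chasles h _ _ _ Hc).
Qed.

Lemma sum_n_m_le_on (a b : nat -> R) (n m : nat) :
  (forall k, (n <= k <= m)%nat -> a k <= b k) ->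
  sum_n_m a n m <= sum_n_m b n m.
Proof.
intros H; destruct (Nat.le_gt_cases n m) as [Hnm|Hnm].
- induction Hnm as [|m Hnm IH].
  + rewrite !sum_n_n; apply H; lia.
  + rewrite !sum_n_Sm by lia.
    apply Rplus_le_compat; [apply IH; intros k Hk|]; apply H; lia.
- rewrite !sum_n_m_zero by lia; apply Rle_refl.
Qed.

Lemma sum_n_m_minus_const (a : nat -> R) (c : R) (m : nat) :
  sum_n_m (fun i => a i - c) 1 m = sum_n_m a 1 m - INR m * c.
Proof.
induction m as [|m IH].
- rewrite !sum_n_m_zero by lia; simpl; unfold zero; simpl; ring.
- rewrite !sum_n_Sm by lia; rewrite IH, S_INR; unfold plus; simpl; ring.
Qed.

Lemma variation_le_arc_length (g h : R -> C) (a b : R) (m : nat) (x : nat -> R) :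
  is_C1_curve g h -> is_partition a b m x -> variation g m x <= arc_length h a b.
Proof.
intros Hg [<- [<- Hx]].
rewrite <- arc_length_partition by apply Hg.
apply sum_n_m_le_on; intros [|i] Hi; [lia|simpl].
apply chord_le_arc_length; auto; apply Rlt_le, Hx; lia.
Qed.

(** On a uniform subdivision finer than the modulus of uniform continuity of the
    velocity, each chord misses its arc by at most [2 * e] times the step; the
    choice of [e] makes the total loss [eps]. *)
Lemma variation_approaches_arc_length (g h : R -> C) (a b eps : R) :
  is_C1_curve g h -> a < b -> 0 < eps ->
  exists m x, is_partition a b m x /\
    arc_length h a b - eps <= variation g m x.
Proof.
intros Hg Hab He.
set (e := eps / (2 * (b - a))).
assert (He' : 0 < e) by (apply Rdiv_lt_0_compat; lra).
destruct (uniform_continuity_on_segment h a b e) as [d [Hd Huc]]; auto.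
{ intros x; apply Hg. }
destruct (INR_unbounded ((b - a) / d)) as [m Hm].
assert (Hm0 : 0 < INR m).
{ apply Rlt_trans with (2 := Hm); apply Rdiv_lt_0_compat; lra. }
set (s := (b - a) / INR m).
assert (Hs : 0 < s) by (apply Rdiv_lt_0_compat; lra).
assert (Hsd : s < d).
{ unfold s; apply Rlt_div_l; auto.
  apply (Rmult_lt_compat_r d) in Hm; auto.
  replace ((b - a) / d * d) with (b - a) in Hm by (field; lra); lra. }
assert (Hsm : INR m * s = b - a) by (unfold s; field; lra).
set (x := fun i => a + INR i * s).
assert (Hpart : is_partition a b m x).
{ unfold is_partition, x; split; [simpl; ring|split].
  - rewrite Hsm; ring.
  - intros i _; rewrite S_INR; lra. }
exists m, x; split; auto.
destruct Hpart as [Hx0 [Hxm _]].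
replace (arc_length h a b - eps)
  with (sum_n_m (fun i => arc_length h (x (pred i)) (x i) - 2 * e * s) 1 m).
- apply sum_n_m_le_on; intros [|i] Hi; [lia|simpl pred].
  assert (Hi1 : 0 <= INR i * s) by (apply Rmult_le_pos; [apply pos_INR|lra]).
  assert (Hi2 : INR (S i) * s <= INR m * s).
  { apply Rmult_le_compat_r; [lra|]; apply le_INR; lia. }
  assert (Hstep : x (S i) - x i = s) by (unfold x; rewrite S_INR; ring).
  rewrite S_INR in Hi2.
  rewrite <- Hstep; apply arc_length_le_chord; auto; [lra|].
  intros t Ht; apply Huc; unfold x in *; rewrite ?S_INR in *; try lra.
  apply Rabs_def1; lra.
- rewrite <- Hx0 at 1; rewrite <- Hxm at 1.
  rewrite <- arc_length_partition by apply Hg.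
  replace eps with (INR m * (2 * e * s)).
  2: { replace (INR m * (2 * e * s)) with (2 * e * (INR m * s)) by ring.
       rewrite Hsm; unfold e; field; lra. }
  apply sum_n_m_minus_const.
Qed.

Lemma total_variation_C1 (g h : R -> C) (a b : R) :
  is_C1_curve g h -> a < b -> total_variation g a b = Finite (arc_length h a b).
Proof.
intros Hg Hab; apply is_lub_Rbar_unique; split.
- intros s [m [x [Hx ->]]]; apply (variation_le_arc_length g h a b m x Hg Hx).
- intros [M| |] HM; simpl; auto.
  + apply le_epsilon; intros eps He.
    destruct (variation_approaches_arc_length g h a b eps Hg Hab He) as [m [x [Hx Hv]]].
    specialize (HM _ (ex_intro _ m (ex_intro _ x (conj Hx eq_refl)))).
    simpl in HM; lra.
  + destruct (variation_approaches_arc_length g h a b 1 Hg Hab Rlt_0_1) as [m [x [Hx Hv]]].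
    apply (HM _ (ex_intro _ m (ex_intro _ x (conj Hx eq_refl)))).
Qed.

(** * Mean values *)

Definition is_mean (f : R -> R) (l : R) : Prop :=
  is_lim (fun T => RInt f 0 T / T) p_infty l.

Lemma is_mean_ext (f g : R -> R) (l : R) :
  (forall t, f t = g t) -> is_mean f l -> is_mean g l.
Proof.
intros Hfg; apply is_lim_ext; intros T.
now rewrite (RInt_ext f g) by auto.
Qed.

Lemma is_mean_plus (f g : R -> R) (lf lg : R) :
  (forall x, continuous f x) -> (forall x, continuous g x) ->
  is_mean f lf -> is_mean g lg -> is_mean (fun t => f t + g t) (lf + lg).
Proof.
intros Cf Cg Hf Hg.
apply (is_lim_ext (fun T => RInt f 0 T / T + RInt g 0 T / T)).
- intros T.
  assert (E : RInt (fun t => f t + g t) 0 T = RInt f 0 T + RInt g 0 T).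
  { apply (RInt_plus (V := R_CompleteNormedModule) f g);
      now apply ex_RInt_continuous_everywhere. }
  rewrite E; unfold Rdiv; ring.
- now apply (is_lim_plus' _ _ p_infty).
Qed.

Lemma is_mean_scal (f : R -> R) (A l : R) :
  (forall x, continuous f x) ->
  is_mean f l -> is_mean (fun t => A * f t) (A * l).
Proof.
intros Cf Hf.
apply (is_lim_ext (fun T => A * (RInt f 0 T / T))).
- intros T.
  assert (E : RInt (fun t => A * f t) 0 T = A * RInt f 0 T).
  { apply (RInt_scal (V := R_CompleteNormedModule) f);
      now apply ex_RInt_continuous_everywhere. }
  rewrite E; unfold Rdiv; ring.
- now apply (is_lim_scal_l _ A p_infty (Finite l)).
Qed.

Lemma is_mean_const (c : R) : is_mean (fun _ => c) c.
Proof.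
apply (is_lim_ext_loc (fun _ => c)).
- exists 0; intros T HT.
  rewrite (RInt_const (V := R_CompleteNormedModule)).
  unfold scal; simpl; unfold mult; simpl; field; lra.
- apply is_lim_const.
Qed.

Lemma is_mean_le (f g : R -> R) (lf lg : R) :
  (forall x, continuous f x) -> (forall x, continuous g x) ->
  (forall t, f t <= g t) -> is_mean f lf -> is_mean g lg -> lf <= lg.
Proof.
intros Cf Cg Hfg Hf Hg.
apply (is_lim_le_loc _ _ p_infty lf lg) with (2 := Hf) (3 := Hg).
exists 0; intros T HT.
apply Rmult_le_compat_r; [apply Rlt_le, Rinv_0_lt_compat, HT|].
apply RInt_le; auto using Rlt_le; now apply ex_RInt_continuous_everywhere.
Qed.

Lemma is_mean_0_of_bounded_integral (f : R -> R) (K : R) :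
  (forall T, Rabs (RInt f 0 T) <= K) -> is_mean f 0.
Proof.
intros HK; apply is_lim_spec; intros eps; simpl.
exists (Rmax 0 (K / eps)); intros T HT.
apply Rmax_Rlt in HT; destruct HT as [HT0 HT1].
rewrite Rminus_0_r, Rabs_div, (Rabs_right T) by lra.
apply Rlt_div_l; auto.
apply Rle_lt_trans with (1 := HK T).
apply (Rmult_lt_compat_r eps) in HT1; [|apply cond_pos].
replace (K / eps * eps) with K in HT1; [lra|].
field; pose proof (cond_pos eps); lra.
Qed.

Lemma continuous_cos_wave (lam phi x : R) :
  continuous (fun t => cos (lam * t + phi)) x.
Proof.
apply (ex_derive_continuous (K := R_AbsRing) (V := R_NormedModule)).
auto_derive; auto.
Qed.

Lemma is_mean_cos_0 (lam phi : R) :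
  lam <> 0 -> is_mean (fun t => cos (lam * t + phi)) 0.
Proof.
intros Hl; apply (is_mean_0_of_bounded_integral _ (2 / Rabs lam)); intros T.
assert (E : is_RInt (fun t => cos (lam * t + phi)) 0 T
              (minus (sin (lam * T + phi) / lam) (sin (lam * 0 + phi) / lam))).
{ apply (is_RInt_derive (V := R_CompleteNormedModule)
           (fun t => sin (lam * t + phi) / lam)).
  - intros x _; auto_derive; auto; field; auto.
  - intros x _; apply continuous_cos_wave. }
rewrite (is_RInt_unique (V := R_CompleteNormedModule) _ _ _ _ E).
unfold minus, plus, opp; simpl.
replace (sin (lam * T + phi) / lam + - (sin (lam * 0 + phi) / lam))
  with ((sin (lam * T + phi) - sin (lam * 0 + phi)) / lam) by (field; auto).
rewrite Rabs_div by auto.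
apply Rmult_le_compat_r; [apply Rlt_le, Rinv_0_lt_compat, Rabs_pos_lt, Hl|].
pose proof (SIN_bound (lam * T + phi)); pose proof (SIN_bound (lam * 0 + phi)).
apply Rabs_le; lra.
Qed.

(** * Real trigonometric polynomials *)

(** Phases make one family of generators enough: sines and constants are cosines.
    Closure under pointwise equality is built in, so that identities between
    functions can be used without extensionality. *)
Inductive trig_poly : (R -> R) -> Prop :=
| trig_poly_cos (A lam phi : R) : trig_poly (fun t => A * cos (lam * t + phi))
| trig_poly_plus (f g : R -> R) :
    trig_poly f -> trig_poly g -> trig_poly (fun t => f t + g t)
| trig_poly_ext (f g : R -> R) :
    (forall t, f t = g t) -> trig_poly f -> trig_poly g.

Lemma trig_poly_const (c : R) : trig_poly (fun _ => c).
Proof.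
apply (trig_poly_ext (fun t => c * cos (0 * t + 0))); [|constructor].
intros t; rewrite Rmult_0_l, Rplus_0_l, cos_0; ring.
Qed.

Lemma trig_poly_scal (c : R) (f : R -> R) :
  trig_poly f -> trig_poly (fun t => c * f t).
Proof.
induction 1 as [A lam phi|f g _ IHf _ IHg|f g Hfg _ IH].
- apply (trig_poly_ext (fun t => (c * A) * cos (lam * t + phi))); [|constructor].
  intros t; ring.
- apply (trig_poly_ext (fun t => c * f t + c * g t)); [|now constructor].
  intros t; ring.
- apply (trig_poly_ext (fun t => c * f t)); auto.
  intros t; now rewrite Hfg.
Qed.

(** Product-to-sum formula for cosines. *)
Lemma trig_poly_mult_cos (A lam phi : R) (f : R -> R) :
  trig_poly f -> trig_poly (fun t => A * cos (lam * t + phi) * f t).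
Proof.
induction 1 as [B mu psi|f g _ IHf _ IHg|f g Hfg _ IH].
- apply (trig_poly_ext (fun t =>
    A * B / 2 * cos ((lam + mu) * t + (phi + psi))
    + A * B / 2 * cos ((lam - mu) * t + (phi - psi)))).
  + intros t.
    replace ((lam + mu) * t + (phi + psi))
      with ((lam * t + phi) + (mu * t + psi)) by ring.
    replace ((lam - mu) * t + (phi - psi))
      with ((lam * t + phi) - (mu * t + psi)) by ring.
    rewrite cos_plus, cos_minus; field.
  + apply trig_poly_plus; constructor.
- apply (trig_poly_ext (fun t => A * cos (lam * t + phi) * f t
                                 + A * cos (lam * t + phi) * g t));
    [intros t; ring|now constructor].
- apply (trig_poly_ext (fun t => A * cos (lam * t + phi) * f t)); auto.
  intros t; now rewrite Hfg.
Qed.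

Lemma trig_poly_mult (f g : R -> R) :
  trig_poly f -> trig_poly g -> trig_poly (fun t => f t * g t).
Proof.
intros Hf Hg; induction Hf as [A lam phi|f1 f2 _ IH1 _ IH2|f1 f2 H12 _ IH].
- now apply trig_poly_mult_cos.
- apply (trig_poly_ext (fun t => f1 t * g t + f2 t * g t));
    [intros t; ring|now constructor].
- apply (trig_poly_ext (fun t => f1 t * g t)); auto.
  intros t; now rewrite H12.
Qed.

Lemma trig_poly_continuous (f : R -> R) :
  trig_poly f -> forall x, continuous f x.
Proof.
induction 1 as [A lam phi|f g _ IHf _ IHg|f g Hfg _ IH]; intros x.
- apply (continuous_scal_r A (fun t => cos (lam * t + phi))).
  apply continuous_cos_wave.
- now apply (continuous_plus f g).
- now apply (continuous_ext f).
Qed.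

Lemma trig_poly_bounded (f : R -> R) :
  trig_poly f -> exists B, forall t, Rabs (f t) <= B.
Proof.
induction 1 as [A lam phi|f g _ [Bf IHf] _ [Bg IHg]|f g Hfg _ [B IH]].
- exists (Rabs A); intros t; rewrite Rabs_mult.
  pose proof (COS_bound (lam * t + phi)).
  assert (Rabs (cos (lam * t + phi)) <= 1) by (apply Rabs_le; lra).
  pose proof (Rabs_pos A); nra.
- exists (Bf + Bg); intros t.
  apply Rle_trans with (1 := Rabs_triang _ _).
  now apply Rplus_le_compat.
- exists B; intros t; now rewrite <- Hfg.
Qed.

Lemma trig_poly_mean (f : R -> R) :
  trig_poly f -> exists l, is_mean f l.
Proof.
induction 1 as [A lam phi|f g Hf [lf IHf] Hg [lg IHg]|f g Hfg _ [l IH]].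
- destruct (Req_dec lam 0) as [->|Hl].
  + exists (A * cos phi).
    apply (is_mean_ext (fun _ => A * cos phi)); [|apply is_mean_const].
    intros t; now rewrite Rmult_0_l, Rplus_0_l.
  + exists (A * 0); apply is_mean_scal; [apply continuous_cos_wave|].
    now apply is_mean_cos_0.
- exists (lf + lg); apply is_mean_plus; auto using trig_poly_continuous.
- exists l; now apply (is_mean_ext f).
Qed.

(** * The mean of the modulus *)

Lemma average_dist_le (f g : R -> R) (eps T : R) :
  (forall x, continuous f x) -> (forall x, continuous g x) ->
  (forall t, Rabs (f t - g t) <= eps) -> 0 < T ->
  Rabs (RInt f 0 T / T - RInt g 0 T / T) <= eps.
Proof.
intros Cf Cg Hfg HT.
assert (E : RInt (fun t => f t - g t) 0 T = RInt f 0 T - RInt g 0 T).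
{ apply (RInt_minus (V := R_CompleteNormedModule) f g);
    now apply ex_RInt_continuous_everywhere. }
replace (RInt f 0 T / T - RInt g 0 T / T)
  with ((RInt f 0 T - RInt g 0 T) / T) by (field; lra).
rewrite <- E, Rabs_div, (Rabs_right T) by lra.
apply Rle_div_l; auto.
replace (eps * T) with ((T - 0) * eps) by ring.
apply abs_RInt_le_const; auto; [lra|].
apply ex_RInt_continuous_everywhere; intros x.
now apply (continuous_minus f g).
Qed.

(** A Cauchy argument: the averages of an approximant converge, and those of [f] stay
    within [eps] of them for every [T]. *)
Lemma mean_exists_of_uniform_limit (f : R -> R) :
  (forall x, continuous f x) ->
  (forall eps, 0 < eps -> exists g, (forall x, continuous g x) /\
     (exists l, is_mean g l) /\ forall t, Rabs (f t - g t) <= eps) ->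
  exists l, is_mean f l.
Proof.
intros Cf Happrox.
apply (filterlim_locally_cauchy (U := R_CompleteSpace)
         (F := Rbar_locally' p_infty) (fun T => RInt f 0 T / T)).
intros eps.
(* Each average of [f] ends up within [2 * (eps / 5)] of the mean of [g]; two of
   them differ by less than [eps]. *)
destruct (Happrox (eps / 5)) as [g [Cg [[l Hl] Hfg]]].
{ pose proof (cond_pos eps); lra. }
assert (He5 : 0 < eps / 5) by (pose proof (cond_pos eps); lra).
apply is_lim_spec in Hl; destruct (Hl (mkposreal _ He5)) as [M HM]; simpl in HM.
exists (fun T => Rmax 0 M < T); split; [now exists (Rmax 0 M)|].
assert (Hnear : forall T, Rmax 0 M < T -> Rabs (RInt f 0 T / T - l) <= 2 * (eps / 5)).
{ intros T HT; apply Rmax_Rlt in HT.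
  pose proof (average_dist_le f g (eps / 5) T Cf Cg Hfg (proj1 HT)).
  pose proof (HM T (proj2 HT)).
  replace (RInt f 0 T / T - l) with
    ((RInt f 0 T / T - RInt g 0 T / T) + (RInt g 0 T / T - l)) by ring.
  apply Rle_trans with (1 := Rabs_triang _ _); lra. }
intros T1 T2 H1 H2; apply Hnear in H1; apply Hnear in H2.
change (Rabs (RInt f 0 T2 / T2 - RInt f 0 T1 / T1) < eps).
apply Rabs_le_between in H1; apply Rabs_le_between in H2.
apply Rabs_def1; lra.
Qed.

(** The classical iteration [p := p + (s - p^2) / 2], which increases to [sqrt s] for
    [s] in [[0, 1]]. *)
Fixpoint sqrt_poly (k : nat) (s : R) : R :=
  match k with
  | O => 0
  | S k => sqrt_poly k s + (s - sqrt_poly k s * sqrt_poly k s) / 2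
  end.

(** With [r = sqrt s], the error [e = r - p] is multiplied by [1 - (r + p) / 2], at
    most [1 - r / 2], at each stage.  Since
    [(1 - r / 2) * (1 + (k + 1) * (r / 2)) <= 1 + k * (r / 2)], the weighted error
    does not increase.  The weight keeps the factor [r] on both sides, which makes the
    resulting bound [e <= 2 / k] uniform near [r = 0]. *)
Lemma sqrt_poly_error (k : nat) (r : R) :
  0 <= r <= 1 ->
  0 <= sqrt_poly k (r * r) <= r /\
  (r - sqrt_poly k (r * r)) * (1 + INR k * (r / 2)) <= r.
Proof.
intros Hr; induction k as [|k [IH1 IH2]]; [simpl; lra|].
rewrite S_INR; cbn [sqrt_poly].
set (p := sqrt_poly k (r * r)) in *.
pose proof (pos_INR k) as Hk; set (n := INR k) in *.
split; [nra|].
replace (r - (p + (r * r - p * p) / 2))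
  with ((r - p) * (1 - (r + p) / 2)) by field.
apply Rle_trans with (2 := IH2).
rewrite Rmult_assoc; apply Rmult_le_compat_l; [lra|].
assert (0 <= n * r) by (apply Rmult_le_pos; lra).
apply Rle_trans with ((1 - r / 2) * (1 + (n + 1) * (r / 2))).
- apply Rmult_le_compat_r; nra.
- nra.
Qed.

Lemma sqrt_poly_uniform (eps : R) :
  0 < eps ->
  exists k, forall r, 0 <= r <= 1 -> Rabs (r - sqrt_poly k (r * r)) <= eps.
Proof.
intros He.
destruct (INR_unbounded (2 / eps)) as [k Hk].
exists k; intros r Hr.
destruct (sqrt_poly_error k r Hr) as [H1 H2].
rewrite Rabs_right by lra.
assert (Hke : 2 < INR k * eps).
{ apply (Rmult_lt_compat_r eps) in Hk; auto.
  replace (2 / eps * eps) with 2 in Hk by (field; lra); lra. }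
set (e := r - sqrt_poly k (r * r)) in *.
destruct (Req_dec r 0) as [Hr0|Hr0]; [subst e; lra|].
apply Rnot_lt_le; intros Hlt.
assert (Hk0 : 0 < INR k) by nra.
assert (INR k * eps < INR k * e) by (apply Rmult_lt_compat_l; lra).
assert (0 < r) by lra.
assert (2 * (r / 2) < (INR k * e) * (r / 2)) by (apply Rmult_lt_compat_r; lra).
nra.
Qed.

Lemma trig_poly_sqrt_poly (k : nat) (f : R -> R) :
  trig_poly f -> trig_poly (fun t => sqrt_poly k (f t)).
Proof.
intros Hf; induction k as [|k IH]; [apply (trig_poly_const 0)|simpl].
apply trig_poly_plus; auto.
apply (trig_poly_ext (fun t =>
  / 2 * (f t + (-1) * (sqrt_poly k (f t) * sqrt_poly k (f t))))).
- intros t; field.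
- apply trig_poly_scal, trig_poly_plus; auto.
  now apply trig_poly_scal, trig_poly_mult.
Qed.

Lemma trig_poly_modulus_mean (u v : R -> R) :
  trig_poly u -> trig_poly v -> exists l, is_mean (fun t => Cmod (u t, v t)) l.
Proof.
intros Hu Hv.
destruct (trig_poly_bounded u Hu) as [Bu HBu].
destruct (trig_poly_bounded v Hv) as [Bv HBv].
(* The summand 1 makes [M] positive, as the rescaling to [[0, 1]] divides by it. *)
set (M := Bu + Bv + 1).
assert (HM : 0 < M /\ forall t, Cmod (u t, v t) <= M).
{ assert (H0 : 0 <= Bu /\ 0 <= Bv).
  { split; [apply Rle_trans with (2 := HBu 0)|apply Rle_trans with (2 := HBv 0)];
      apply Rabs_pos. }
  split; [unfold M; lra|intros t].
  destruct (exists_polar_unit (u t, v t)) as [p [q [Hpq <-]]]; simpl.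
  specialize (HBu t); specialize (HBv t).
  apply Rabs_le_between in HBu; apply Rabs_le_between in HBv.
  assert (-1 <= p <= 1) by nra.
  assert (-1 <= q <= 1) by nra.
  unfold M; nra. }
destruct HM as [HM HuvM].
apply mean_exists_of_uniform_limit.
{ intros x; unfold Cmod; apply continuous_sqrt_comp; simpl.
  apply trig_poly_continuous.
  apply trig_poly_plus; repeat apply trig_poly_mult; auto; apply trig_poly_const. }
intros eps He.
destruct (sqrt_poly_uniform (eps / M)) as [k Hk]; [now apply Rdiv_lt_0_compat|].
set (s := fun t => / (M * M) * (u t * u t + v t * v t)).
assert (Hs : trig_poly (fun t => M * sqrt_poly k (s t))).
{ apply trig_poly_scal, trig_poly_sqrt_poly, trig_poly_scal.
  apply trig_poly_plus; now apply trig_poly_mult. }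
exists (fun t => M * sqrt_poly k (s t)); split; [|split].
- now apply trig_poly_continuous.
- now apply trig_poly_mean.
- intros t.
  set (r := Cmod (u t, v t) / M).
  assert (Hr : 0 <= r <= 1).
  { split.
    - apply Rmult_le_pos; [apply Cmod_ge_0|apply Rlt_le, Rinv_0_lt_compat, HM].
    - apply Rle_div_l; auto; rewrite Rmult_1_l; apply HuvM. }
  assert (Hsr : s t = r * r).
  { assert (HC : Cmod (u t, v t) * Cmod (u t, v t) = u t * u t + v t * v t).
    { unfold Cmod; rewrite sqrt_sqrt; simpl; nra. }
    unfold s, r; rewrite <- HC; field; lra. }
  rewrite Hsr.
  replace (Cmod (u t, v t)) with (M * r) by (unfold r; field; lra).
  rewrite <- Rmult_minus_distr_l, Rabs_mult, (Rabs_right M) by lra.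
  specialize (Hk r Hr).
  apply (Rmult_le_compat_l M) in Hk; [|lra].
  replace (M * (eps / M)) with eps in Hk by (field; lra); exact Hk.
Qed.

(** * Trigonometric curves *)

(** The complex exponential sum of [r n * exp (i * (phi - lam n * t))] for
    [1 <= n <= N], by components; the phase [phi] is common to all the terms. *)
Definition wave (N : nat) (lam r : nat -> R) (phi t : R) : C :=
  (sum_n_m (fun n => r n * cos (- lam n * t + phi)) 1 N,
   sum_n_m (fun n => r n * sin (- lam n * t + phi)) 1 N).

Lemma is_derive_sum_1 (N : nat) (f df : nat -> R -> R) (t : R) :
  (forall n, is_derive (f n) t (df n t)) ->
  is_derive (fun s => sum_n_m (fun n => f n s) 1 N) t
    (sum_n_m (fun n => df n t) 1 N).
Proof.
intros Hf; induction N as [|N IH].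
- apply (is_derive_ext (fun _ => 0)).
  + intros s; now rewrite sum_n_m_zero by lia.
  + rewrite sum_n_m_zero by lia; apply (is_derive_const (V := R_NormedModule)).
- apply (is_derive_ext (fun s => sum_n_m (fun n => f n s) 1 N + f (S N) s)).
  + intros s; now rewrite sum_n_Sm by lia.
  + rewrite sum_n_Sm by lia.
    now apply (is_derive_plus (V := R_NormedModule)
                 (fun s => sum_n_m (fun n => f n s) 1 N)).
Qed.

(** The derivative of [exp (i * (phi - lam * t))] carries the factor [- i * lam], and
    [- i] is a phase of [- PI / 2]. *)
Lemma is_derive_wave (N : nat) (lam r : nat -> R) (phi t : R) :
  is_derive (K := R_AbsRing) (V := C_R_NormedModule) (wave N lam r phi) t
    (wave N lam (fun n => r n * lam n) (phi - PI / 2) t).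
Proof.
apply is_derive_pair.
- apply (is_derive_sum_1 N (fun n s => r n * cos (- lam n * s + phi))
           (fun n s => r n * lam n * cos (- lam n * s + (phi - PI / 2)))).
  intros n; auto_derive; auto.
  replace (- lam n * t + (phi - PI / 2))
    with (- (PI / 2 - (- lam n * t + phi))) by ring.
  rewrite cos_neg, cos_shift; ring.
- apply (is_derive_sum_1 N (fun n s => r n * sin (- lam n * s + phi))
           (fun n s => r n * lam n * sin (- lam n * s + (phi - PI / 2)))).
  intros n; auto_derive; auto.
  replace (- lam n * t + (phi - PI / 2))
    with (- (PI / 2 - (- lam n * t + phi))) by ring.
  rewrite sin_neg, sin_shift; ring.
Qed.

Lemma trig_poly_sum_1 (N : nat) (f : nat -> R -> R) :
  (forall n, trig_poly (f n)) ->
  trig_poly (fun t => sum_n_m (fun n => f n t) 1 N).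
Proof.
intros Hf; induction N as [|N IH].
- apply (trig_poly_ext (fun _ => 0)); [|apply trig_poly_const].
  intros t; now rewrite sum_n_m_zero by lia.
- apply (trig_poly_ext (fun t => sum_n_m (fun n => f n t) 1 N + f (S N) t)).
  + intros t; now rewrite sum_n_Sm by lia.
  + now apply trig_poly_plus.
Qed.

Lemma trig_poly_wave (N : nat) (lam r : nat -> R) (phi : R) :
  trig_poly (fun t => fst (wave N lam r phi t)) /\
  trig_poly (fun t => snd (wave N lam r phi t)).
Proof.
split.
- apply (trig_poly_sum_1 N (fun n t => r n * cos (- lam n * t + phi))).
  intros n; constructor.
- apply (trig_poly_sum_1 N (fun n t => r n * sin (- lam n * t + phi))).
  intros n.
  apply (trig_poly_ext (fun t => r n * cos (- lam n * t + (phi - PI / 2))));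
    [|constructor].
  intros t; replace (- lam n * t + (phi - PI / 2))
    with (- (PI / 2 - (- lam n * t + phi))) by ring.
  now rewrite cos_neg, cos_shift.
Qed.

Lemma continuous_wave (N : nat) (lam r : nat -> R) (phi x : R) :
  continuous (wave N lam r phi) x.
Proof.
apply (ex_derive_continuous (K := R_AbsRing) (V := C_R_NormedModule)).
eexists; apply is_derive_wave.
Qed.

Lemma wave_C1 (N : nat) (lam r : nat -> R) (phi : R) :
  is_C1_curve (wave N lam r phi)
    (wave N lam (fun n => r n * lam n) (phi - PI / 2)).
Proof.
intros x; split; [apply is_derive_wave|apply continuous_wave].
Qed.

(** The left-hand side is the projection of the curve on the unit vector
    [exp (i * (phi - mu * t))].  The summand 0 gives the cosines the shape of the
    generators of trigonometric polynomials. *)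
Lemma cos_sum_le_Cmod_wave (N : nat) (lam r : nat -> R) (phi mu t : R) :
  sum_n_m (fun n => r n * cos ((mu - lam n) * t + 0)) 1 N
  <= Cmod (wave N lam r phi t).
Proof.
set (a := - mu * t + phi).
apply Rle_trans with (2 := dot_unit_le_Cmod (cos a) (sin a) _
  (eq_trans (Rplus_comm _ _) (sin2_cos2 a))).
apply Req_le; unfold wave; cbn [fst snd].
induction N as [|N IH].
- rewrite !sum_n_m_zero by lia; unfold zero; simpl; ring.
- rewrite !sum_n_Sm by lia; rewrite IH; unfold plus; simpl.
  replace ((mu - lam (S N)) * t + 0)
    with ((- lam (S N) * t + phi) - a) by (unfold a; ring).
  rewrite cos_minus; ring.
Qed.

(** Each cosine has mean 1 if its frequency vanishes and 0 otherwise.  As the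
    amplitudes are nonnegative, terms that share the frequency [mu] cannot cancel. *)
Lemma is_mean_cos_sum (N : nat) (lam r : nat -> R) (mu : R) :
  (forall n, (1 <= n <= N)%nat -> 0 <= r n) ->
  exists l,
    is_mean (fun t => sum_n_m (fun n => r n * cos ((mu - lam n) * t + 0)) 1 N) l /\
    0 <= l /\
    forall n, (1 <= n <= N)%nat -> lam n = mu -> r n <= l.
Proof.
induction N as [|N IH]; intros Hr.
- exists 0; split; [|split; [lra|lia]].
  apply (is_mean_ext (fun _ => 0)); [|apply is_mean_const].
  intros t; now rewrite sum_n_m_zero by lia.
- destruct IH as [l [Hl [Hl0 Hlr]]]; [intros n Hn; apply Hr; lia|].
  assert (HrS : 0 <= r (S N)) by (apply Hr; lia).
  assert (Hterm : exists d, is_mean (fun t => cos ((mu - lam (S N)) * t + 0)) d /\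
            0 <= d /\ (lam (S N) = mu -> d = 1)).
  { destruct (Req_dec (lam (S N)) mu) as [He|Hne].
    - exists 1; split; [|split; [lra|auto]].
      apply (is_mean_ext (fun _ => 1)); [|apply is_mean_const].
      intros t; rewrite He.
      replace ((mu - mu) * t + 0) with 0 by ring; now rewrite cos_0.
    - exists 0; split; [|split; [lra|tauto]].
      apply is_mean_cos_0; lra. }
  destruct Hterm as [d [Hd [Hd0 Hd1]]].
  exists (l + r (S N) * d); split; [|split].
  + apply (is_mean_ext (fun t =>
      sum_n_m (fun n => r n * cos ((mu - lam n) * t + 0)) 1 N
      + r (S N) * cos ((mu - lam (S N)) * t + 0))).
    { intros t; now rewrite sum_n_Sm by lia. }
    apply is_mean_plus; auto.
    * apply trig_poly_continuous.
      apply (trig_poly_sum_1 N (fun n t => r n * cos ((mu - lam n) * t + 0))).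
      intros n; constructor.
    * apply trig_poly_continuous; constructor.
    * apply is_mean_scal; auto; apply continuous_cos_wave.
  + nra.
  + intros n Hn Hln; destruct (Nat.eq_dec n (S N)) as [->|Hne].
    * rewrite (Hd1 Hln); lra.
    * pose proof (Hlr n ltac:(lia) Hln); nra.
Qed.

Lemma wave_amplitude_le_mean (N : nat) (lam r : nat -> R) (phi l : R) :
  (forall n, (1 <= n <= N)%nat -> 0 <= r n) ->
  is_mean (fun t => Cmod (wave N lam r phi t)) l ->
  forall n, (1 <= n <= N)%nat -> r n <= l.
Proof.
intros Hr Hl n Hn.
destruct (is_mean_cos_sum N lam r (lam n) Hr) as [c [Hc [_ Hcr]]].
apply Rle_trans with (1 := Hcr n Hn eq_refl).
apply (is_mean_le
  (fun t => sum_n_m (fun m => r m * cos ((lam n - lam m) * t + 0)) 1 N)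
  (fun t => Cmod (wave N lam r phi t))); auto.
- apply trig_poly_continuous.
  apply (trig_poly_sum_1 N (fun m t => r m * cos ((lam n - lam m) * t + 0))).
  intros m; constructor.
- intros x; apply continuous_Cmod_comp, continuous_wave.
- intros t; apply cos_sum_le_Cmod_wave.
Qed.

(** Stated for [g] pointwise equal to a curve, because the iterated derivatives are
    known only pointwise. *)
Lemma wave_average_variation (N : nat) (lam r : nat -> R) (phi : R) (g : R -> C) :
  (forall n, (1 <= n <= N)%nat -> 0 <= r n * lam n) ->
  (forall t, g t = wave N lam r phi t) ->
  exists L, is_average_variation g L /\
    forall n, (1 <= n <= N)%nat -> r n * lam n <= L.
Proof.
intros Hr Hg.
set (h := wave N lam (fun n => r n * lam n) (phi - PI / 2)).
assert (HgC1 : is_C1_curve g h).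
{ intros x; destruct (wave_C1 N lam r phi x) as [H1 H2]; split; auto.
  now apply (is_derive_ext (wave N lam r phi)). }
destruct (trig_poly_wave N lam (fun n => r n * lam n) (phi - PI / 2)) as [Hu Hv].
destruct (trig_poly_modulus_mean _ _ Hu Hv) as [L HL].
assert (HhL : is_mean (fun t => Cmod (h t)) L) by exact HL.
exists L; split; [split|].
- intros T HT; rewrite (total_variation_C1 g h 0 T HgC1 HT); reflexivity.
- apply (is_lim_ext_loc (fun T => RInt (fun t => Cmod (h t)) 0 T / T)); auto.
  exists 0; intros T HT; now rewrite (total_variation_C1 g h 0 T HgC1 HT).
- now apply (wave_amplitude_le_mean N lam (fun n => r n * lam n) (phi - PI / 2)).
Qed.

(** * The zeta sum *)

Lemma zeta_half_wave (N : nat) (t : R) :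
  zeta_half N t
  = wave N (fun n => ln (INR n)) (fun n => Rpower (INR n) (-1 / 2)) 0 t.
Proof.
unfold zeta_half, wave; induction N as [|N IH].
- now rewrite !sum_n_m_zero by lia.
- rewrite !sum_n_Sm by lia; rewrite IH; clear IH.
  assert (E : forall c l : R,
    (RtoC c * Cexp (- (Ci * RtoC t * RtoC l)))%C
    = (c * cos (- l * t + 0), c * sin (- l * t + 0))).
  { intros c l; unfold Cexp; simpl.
    replace (- ((0 * t - 1 * 0) * l - (0 * 0 + 1 * t) * 0)) with 0 by ring.
    replace (- ((0 * t - 1 * 0) * 0 + (0 * 0 + 1 * t) * l))
      with (- l * t + 0) by ring.
    rewrite exp_0; unfold Cmult; simpl; f_equal; ring. }
  rewrite E; reflexivity.
Qed.

Lemma CDerive_n_zeta_half (N J : nat) (t : R) :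
  CDerive_n (zeta_half N) J t
  = wave N (fun n => ln (INR n))
      (fun n => Rpower (INR n) (-1 / 2) * ln (INR n) ^ J) (- INR J * (PI / 2)) t.
Proof.
revert t; induction J as [|J IH]; intros t.
- simpl CDerive_n; rewrite zeta_half_wave; unfold wave.
  f_equal; apply sum_n_m_ext; intros n; simpl; f_equal; try ring; f_equal; ring.
- cbn [CDerive_n]; apply CDerive_eq.
  apply (is_derive_ext (V := C_R_NormedModule) _ _ _ _ (fun s => eq_sym (IH s))).
  replace (wave N (fun n => ln (INR n))
    (fun n => Rpower (INR n) (-1 / 2) * ln (INR n) ^ S J) (- INR (S J) * (PI / 2)) t)
  with (wave N (fun n => ln (INR n))
    (fun n => Rpower (INR n) (-1 / 2) * ln (INR n) ^ J * ln (INR n))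
    (- INR J * (PI / 2) - PI / 2) t).
  + apply is_derive_wave.
  + rewrite S_INR; unfold wave.
    replace (- (INR J + 1) * (PI / 2)) with (- INR J * (PI / 2) - PI / 2) by ring.
    f_equal; apply sum_n_m_ext; intros n; simpl; ring.
Qed.

Lemma max_upto_le (a : nat -> R) (N : nat) (L : R) :
  (1 <= N)%nat -> (forall n, (1 <= n <= N)%nat -> a n <= L) -> max_upto a N <= L.
Proof.
intros HN Ha.
assert (Hin : In (max_upto a N) (map a (seq 1 N))).
{ apply MaxRlist_P2; exists (a 1%nat); apply in_map, in_seq; lia. }
apply in_map_iff in Hin; destruct Hin as [n [<- Hn]].
apply Ha; apply in_seq in Hn; lia.
Qed.

Theorem theorem4 :
  forall N : nat, (1 <= N)%nat ->
  forall J : nat,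
  exists L : R,
    is_average_variation (CDerive_n (zeta_half N) J) L /\
    L >= max_upto (fun n : nat => Rpower (INR n) (-1/2) * ln (INR n) ^ (J + 1)) N.
Proof.
intros N HN J.
assert (Hln : forall n, (1 <= n)%nat -> 0 <= ln (INR n)).
{ intros n Hn; rewrite <- ln_1; apply ln_le; [lra|].
  now apply (le_INR 1). }
destruct (wave_average_variation N (fun n => ln (INR n))
  (fun n => Rpower (INR n) (-1 / 2) * ln (INR n) ^ J) (- INR J * (PI / 2))
  (CDerive_n (zeta_half N) J)) as [L [HL HLn]].
- intros n Hn; specialize (Hln n (proj1 Hn)).
  apply Rmult_le_pos; auto; apply Rmult_le_pos; [|now apply pow_le].
  unfold Rpower; apply Rlt_le, exp_pos.
- apply CDerive_n_zeta_half.
- exists L; split; auto.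
  apply Rle_ge, max_upto_le; auto.
  intros n Hn; rewrite pow_add, pow_1, <- Rmult_assoc; now apply HLn.
Qed.
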